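(* Let $\mathcal T\in\mathbb C^{n^{\times d}}_{ps}$. Then $$\rho(\mathcal T)\le\|\mathcal T\|_\infty\,n^{(d-2)/2}.$$
   Context: Let $n\ge1$, $d\ge3$ be integers, $[n]=\{1,\dots,n\}$. $\mathbb C^{n^{\times d}}_{ps}$ is the space of complex tensors $\mathcal T=[t_{i_1,\dots,i_d}]$, $i_1,\dots,i_d\in[n]$, with entries symmetric in the last $d-1$ indices. For $x\in\mathbb C^n$, $\mathcal T(x)_i=\sum_{i_2,\dots,i_d\in[n]}t_{i,i_2,\dots,i_d}x_{i_2}\cdots x_{i_d}$, and $x^{\circ p}=(x_1^p,\dots,x_n^p)^\top$. An eigenvalue of $\mathcal T$ is $\lambda\in\mathbb C$ with $\mathcal T(x)=\lambda x^{\circ(d-1)}$ for some nonzero $x\in\mathbb C^n$; the spectral radius $\rho(\mathcal T)$ is the maximum modulus of the eigenvalues. The spectral norm is $\|\mathcal T\|_\infty=\max\left\{\left|\sum_{i_1,\dots,i_d\in[n]}t_{i_1,\dots,i_d}x_{i_1,1}\cdots x_{i_d,d}\right|:\ x_j=(x_{1,j},\dots,x_{n,j})^\top\in\mathbb C^n,\ \|x_j\|=1,\ j=1,\dots,d\right\}$, where $\|\cdot\|$ is the Euclidean norm on $\mathbb C^n$. *)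

(* Defs.v *)
From HB Require Import structures.
From mathcomp Require Import all_boot all_order all_algebra.
From mathcomp Require Import all_classical all_reals exp.
From mathcomp.real_closed Require Import complex.

Set Implicit Arguments.
Unset Strict Implicit.
Unset Printing Implicit Defensive.

Import Order.TTheory GRing.Theory Num.Theory.

Local Open Scope classical_set_scope.
Local Open Scope ring_scope.

(* Indices run over 'I_n = {0, ..., n-1}; the multi-index (i_1, ..., i_d) is
   the tuple [tuple i_1; ...; i_d], so that its head is i_1 and its behead is
   the sequence i_2, ..., i_d. *)
Definition tensor (R : realType) (n d : nat) : Type :=
  {ffun d.-tuple 'I_n -> R[i]}.

Definition partially_symmetric (R : realType) (n d : nat)
    (T : tensor R n d) : Prop :=
  forall i j : d.-tuple 'I_n,
    ohead i = ohead j -> perm_eq (behead i) (behead j) -> T i = T j.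

Definition tensor_map (R : realType) (n d : nat) (T : tensor R n d)
    (x : 'cV[R[i]]_n) : 'cV[R[i]]_n :=
  \col_i \sum_(j : d.-tuple 'I_n | ohead j == Some i)
     T j * \prod_(k <- behead j) x k 0.

Definition hadamard_pow (R : realType) (n : nat) (x : 'cV[R[i]]_n) (p : nat) :
    'cV[R[i]]_n :=
  map_mx (fun z => z ^+ p) x.

Definition tensor_eigenvalue (R : realType) (n d : nat) (T : tensor R n d)
    (l : R[i]) : Prop :=
  exists2 x : 'cV[R[i]]_n,
    x != 0 & tensor_map T x = l *: hadamard_pow x (d - 1)%N.

(* [ComplexField.Normc.normc] is the modulus as an element of R. *)
Definition modulus (R : realType) (z : R[i]) : R := ComplexField.Normc.normc z.

(* The norm that the library attaches to matrices is the max-norm, hence an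
   explicit Euclidean norm. *)
Definition euclidean_norm (R : realType) (n : nat) (x : 'cV[R[i]]_n) : R :=
  Num.sqrt (\sum_i modulus (x i 0) ^+ 2).

(* [sup] is the maximum of any set that has one. Its default value 0 on empty
   or unbounded sets is not met for 0 < n and 2 <= d: there are finitely many
   eigenvalues and at least one, and the unit spheres are nonempty compacts. *)
Definition spectral_radius (R : realType) (n d : nat) (T : tensor R n d) : R :=
  sup [set modulus l | l in [set l : R[i] | tensor_eigenvalue T l]].

Definition multilinear_form (R : realType) (n d : nat) (T : tensor R n d)
    (x : 'I_d -> 'cV[R[i]]_n) : R[i] :=
  \sum_(j : d.-tuple 'I_n) T j * \prod_(k < d) x k (tnth j k) 0.

Definition spectral_norm (R : realType) (n d : nat) (T : tensor R n d) : R :=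
  sup [set modulus (multilinear_form T x) |
        x in [set x : 'I_d -> 'cV[R[i]]_n |
               forall k, euclidean_norm (x k) = 1]].

(* Main.v *)
Require Import Defs.
From mathcomp Require Import all_boot all_order all_algebra.
From mathcomp Require Import all_classical all_reals exp.
From mathcomp.real_closed Require Import complex.
From mathcomp Require Import ring.
Import Order.TTheory GRing.Theory Num.Theory.
Local Open Scope ring_scope.

(* If [T(x) = l x^(d-1)], evaluate the multilinear form at [conj (x^(d-1))] in
   the first slot and [x] in the others: the value is [l] times the squared
   norm of [x^(d-1)], so [|l| * ||x^(d-1)|| <= ||T|| * ||x||^(d-1)].  The power
   mean inequality [||x||^(2(d-1)) <= n^(d-2) * ||x^(d-1)||^2] concludes. *)

(** Induction on [m]: multiplying the bound for [m] by the sum of the [a i] leaves the product of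
    this sum with the sum of the powers [a i ^+ m.+1], and Chebyshev's inequality trades that
    product for one more factor [#|I|]. *)
Lemma power_mean (R : realFieldType) (I : finType) (a : I -> R) (m : nat) :
  (forall i, 0 <= a i) ->
  (\sum_i a i) ^+ m.+1 <= #|I|%:R ^+ m * \sum_i a i ^+ m.+1.
Proof.
move=> a0; elim: m => [|m IHm].
  by rewrite expr0 mul1r expr1; apply: ler_sum => i _; rewrite expr1.
(* Chebyshev's sum inequality, from [0 <= (a_i - a_j)(a_i^m - a_j^m)]. *)
have cheb : (\sum_i a i) * (\sum_i a i ^+ m.+1)
    <= #|I|%:R * \sum_i a i ^+ m.+2.
  have : 0 <= \sum_i \sum_j (a i - a j) * (a i ^+ m.+1 - a j ^+ m.+1).
    apply: sumr_ge0 => i _; apply: sumr_ge0 => j _.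
    have [le_ij|/ltW le_ji] := leP (a i) (a j).
      by rewrite mulr_le0 ?subr_le0 // lerXn2r // nnegrE.
    by rewrite mulr_ge0 ?subr_ge0 // lerXn2r // nnegrE.
  have -> : \sum_(i : I) \sum_(j : I) (a i - a j) * (a i ^+ m.+1 - a j ^+ m.+1) =
      \sum_(i : I) \sum_(j : I) a i ^+ m.+2
      + \sum_(i : I) \sum_(j : I) a j ^+ m.+2
      - (\sum_i \sum_j a i * a j ^+ m.+1 + \sum_i \sum_j a j * a i ^+ m.+1).
    rewrite -!big_split /= -sumrB; apply: eq_bigr => i _.
    rewrite -!big_split /= -sumrB; apply: eq_bigr => j _.
    by rewrite ![_ ^+ m.+2]exprS; ring.
  (* Exchanging the order of summation identifies the two sums in each pair, so the nonnegative
     quantity is twice the difference of the two sides of [cheb]. *)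
  rewrite [X in _ + X - _]exchange_big [X in _ - (_ + X)]exchange_big /=.
  rewrite -big_distrlr /=.
  under eq_bigr => i _ do rewrite sumr_const -mulr_natl.
  rewrite -big_distrr /= -!mulr2n -mulrnBl pmulrn_lge0 // subr_ge0.
  exact.
rewrite exprS.
apply: (le_trans (ler_wpM2l (sumr_ge0 _ (fun i _ => a0 i)) IHm)).
by rewrite mulrCA exprSr -mulrA ler_wpM2l // exprn_ge0.
Qed.

Section Modulus.
Variable R : realType.
Implicit Types z w : R[i].

(** This identity lets the norm lemmas of [R[i]] pass to the real-valued [modulus], through the
    injective, order-preserving embedding of [R]. *)
Lemma modulusE z : (modulus z)%:C%C = `|z|. Proof. by []. Qed.

Lemma modulus_ge0 z : 0 <= modulus z.
Proof. by case: z => a b; apply: sqrtr_ge0. Qed.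

Lemma modulusM z w : modulus (z * w) = modulus z * modulus w.
Proof. exact: ComplexField.Normc.normcM. Qed.

Lemma modulusX z k : modulus (z ^+ k) = modulus z ^+ k.
Proof.
by apply: (@complexI R); rewrite rmorphXn /= !modulusE normrX.
Qed.

Lemma modulusJ z : modulus (conjc z) = modulus z.
Proof. by apply: (@complexI R); rewrite !modulusE normcJ. Qed.

Lemma modulusR (r : R) : 0 <= r -> modulus r%:C%C = r.
Proof. by move=> r0; apply: (@complexI R); rewrite modulusE ger0_norm ?lecR. Qed.

Lemma modulus_prod (I : Type) (s : seq I) (P : pred I) (F : I -> R[i]) :
  modulus (\prod_(i <- s | P i) F i) = \prod_(i <- s | P i) modulus (F i).
Proof.
by apply: (@complexI R); rewrite rmorph_prod /= modulusE normr_prod.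
Qed.

Lemma modulus_sum (I : Type) (s : seq I) (P : pred I) (F : I -> R[i]) :
  modulus (\sum_(i <- s | P i) F i) <= \sum_(i <- s | P i) modulus (F i).
Proof. by rewrite -lecR rmorph_sum /= modulusE ler_norm_sum. Qed.

Lemma sqr_modulus z : (modulus z ^+ 2)%:C%C = conjc z * z.
Proof. by rewrite rmorphXn /= modulusE sqr_normc mulrC. Qed.

End Modulus.

Section Norms.
Variables (R : realType) (n : nat).
Implicit Types x : 'cV[R[i]]_n.

Lemma sqr_euclidean_norm x :
  euclidean_norm x ^+ 2 = \sum_i modulus (x i 0) ^+ 2.
Proof. by rewrite sqr_sqrtr // sumr_ge0 // => i _; rewrite sqr_ge0. Qed.

Lemma modulus_le_euclidean_norm x i : modulus (x i 0) <= euclidean_norm x.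
Proof.
rewrite -(@ler_pXn2r _ 2) ?nnegrE ?modulus_ge0 ?sqrtr_ge0 //.
rewrite sqr_euclidean_norm (bigD1 i) //= lerDl sumr_ge0 // => j _.
exact: sqr_ge0.
Qed.

Lemma euclidean_norm_gt0 x : x != 0 -> 0 < euclidean_norm x.
Proof.
move=> x0; rewrite lt_def sqrtr_ge0 andbT; apply: contra x0 => /eqP N0.
apply/eqP/matrixP => i j; rewrite ord1 mxE.
apply: ComplexField.Normc.eq0_normc; apply/eqP.
by rewrite eq_le modulus_ge0 andbT -N0 modulus_le_euclidean_norm.
Qed.

Lemma euclidean_normZ (c : R[i]) x :
  euclidean_norm (c *: x) = modulus c * euclidean_norm x.
Proof.
apply/eqP; rewrite -(@eqrXn2 _ 2) ?mulr_ge0 ?modulus_ge0 ?sqrtr_ge0 //.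
rewrite exprMn !sqr_euclidean_norm mulr_sumr; apply/eqP/eq_bigr => i _.
by rewrite mxE modulusM exprMn.
Qed.

End Norms.

Section SpectralNorm.
Variables (R : realType) (n d : nat) (T : tensor R n d).

Lemma multilinear_formZ (c : 'I_d -> R[i]) (x : 'I_d -> 'cV[R[i]]_n) :
  multilinear_form T (fun k => c k *: x k) =
  (\prod_k c k) * multilinear_form T x.
Proof.
rewrite /multilinear_form mulr_sumr; apply: eq_bigr => j _.
rewrite mulrCA -big_split /=; congr (_ * _); apply: eq_bigr => k _.
by rewrite mxE.
Qed.

(** Coordinates of unit vectors have modulus at most 1. This crude bound serves to show that the set
    whose [sup] is [spectral_norm] is bounded above. *)
Lemma multilinear_form_le_sum (x : 'I_d -> 'cV[R[i]]_n) :
  (forall k, euclidean_norm (x k) = 1) ->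
  modulus (multilinear_form T x) <= \sum_j modulus (T j).
Proof.
move=> x1; apply: le_trans (modulus_sum _ _ _ _ _) _; apply: ler_sum => j _.
rewrite modulusM modulus_prod ler_piMr ?modulus_ge0 //.
apply: prodr_ile1 => k _; rewrite modulus_ge0 -(x1 k).
exact: modulus_le_euclidean_norm.
Qed.

Lemma multilinear_form_le_unit (x : 'I_d -> 'cV[R[i]]_n) :
  (forall k, euclidean_norm (x k) = 1) ->
  modulus (multilinear_form T x) <= spectral_norm T.
Proof.
move=> x1; apply: ub_le_sup; last by exists x.
by exists (\sum_j modulus (T j)) => _ [y y1 <-]; apply: multilinear_form_le_sum.
Qed.

(** By homogeneity in each slot, it suffices to rescale every [x k] to norm 1; the scalars [c k]
    below do this. *)
Lemma multilinear_form_le (x : 'I_d -> 'cV[R[i]]_n) :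
  (forall k, x k != 0) ->
  modulus (multilinear_form T x) <=
  spectral_norm T * \prod_k euclidean_norm (x k).
Proof.
move=> x0; have N0 k := @euclidean_norm_gt0 _ _ _ (x0 k).
pose c k := ((euclidean_norm (x k))^-1)%:C%C : R[i].
have cE k : modulus (c k) = (euclidean_norm (x k))^-1.
  by rewrite modulusR // invr_ge0 ltW.
have := @multilinear_form_le_unit (fun k => c k *: x k).
rewrite multilinear_formZ modulusM modulus_prod.
under eq_bigr => k _ do rewrite cE.
rewrite prodfV ler_pdivrMl ?prodr_gt0 // mulrC; apply=> k.
by rewrite euclidean_normZ cE mulVf // gt_eqF.
Qed.

Lemma spectral_norm_ge0 : 0 <= spectral_norm T.
Proof.
have [[x x1]|no_x] := pselect (exists x : 'I_d -> 'cV[R[i]]_n,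
    forall k, euclidean_norm (x k) = 1).
  exact: le_trans (modulus_ge0 _ _) (@multilinear_form_le_unit _ x1).
(* With no family of unit vectors ([n = 0] and [0 < d]), [sup] takes its default value 0. *)
rewrite /spectral_norm sup_out // => -[[_ [x x1 _]] _].
by apply: no_x; exists x.
Qed.

End SpectralNorm.

(** Group the multi-indices by their head [i]: slot 0 contributes the common factor [y i 0], and the
    sum over the tails is coordinate [i] of [tensor_map T x]. *)
Lemma multilinear_form_tensor_map (R : realType) (n p : nat)
    (T : tensor R n p.+1) (y x : 'cV[R[i]]_n) :
  multilinear_form T (fun k => if k == ord0 then y else x) =
  \sum_i y i 0 * tensor_map T x i 0.
Proof.
rewrite /multilinear_form (partition_big (@thead p 'I_n) xpredT) //=.
apply: eq_bigr => i _; rewrite mxE mulr_sumr; apply: eq_big => [j|j /eqP <-].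
  by case/tupleP: j => a t; rewrite theadE.
rewrite big_ord_recl /= mulrCA; congr (_ * (_ * _)).
case/tupleP: j => a t; rewrite /= big_tuple; apply: eq_bigr => k _.
by rewrite tnthS.
Qed.

Lemma sqr_modulus_sum_conj (R : realType) (n : nat) (x : 'cV[R[i]]_n) :
  \sum_i conjc (x i 0) * x i 0 = (euclidean_norm x ^+ 2)%:C%C.
Proof.
rewrite sqr_euclidean_norm rmorph_sum /=; apply: eq_bigr => i _.
by rewrite sqr_modulus.
Qed.

Lemma euclidean_norm_conj (R : realType) (n : nat) (x : 'cV[R[i]]_n) :
  euclidean_norm (map_mx conjc x) = euclidean_norm x.
Proof.
by congr Num.sqrt; apply: eq_bigr => i _; rewrite mxE modulusJ.
Qed.

Lemma hadamard_pow_neq0 (R : realType) (n p : nat) (x : 'cV[R[i]]_n) :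
  x != 0 -> hadamard_pow x p != 0.
Proof.
move=> x0; apply: contra x0 => /eqP xp0; apply/eqP/matrixP => i j.
rewrite mxE; apply/eqP; move/matrixP/(_ i j)/eqP: xp0.
by rewrite !mxE expf_eq0 => /andP[].
Qed.

(** After squaring, this is [power_mean] for the numbers [modulus (x i 0) ^+ 2]. *)
Lemma euclidean_norm_pow_le (R : realType) (n m : nat) (x : 'cV[R[i]]_n) :
  euclidean_norm x ^+ m.+1 <=
  Num.sqrt (n%:R ^+ m) * euclidean_norm (hadamard_pow x m.+1).
Proof.
rewrite -(@ler_pXn2r _ 2) ?nnegrE ?mulr_ge0 ?exprn_ge0 ?sqrtr_ge0 //.
rewrite exprMn sqr_sqrtr ?exprn_ge0 // exprAC !sqr_euclidean_norm.
have := @power_mean R _ (fun i => modulus (x i 0) ^+ 2) m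
  (fun i => sqr_ge0 _).
rewrite card_ord; under [X in _ * X]eq_bigr do rewrite exprAC -modulusX.
by under [X in _ -> _ <= _ * X]eq_bigr do rewrite mxE.
Qed.

(** The order [d] is written [m.+2], so [m.+1] is the exponent [d - 1] of the eigenvalue equation
    and [m] the exponent [d - 2] of the bound. *)
Lemma tensor_eigenvalue_le (R : realType) (n m : nat) (T : tensor R n m.+2)
    (l : R[i]) :
  tensor_eigenvalue T l -> modulus l <= spectral_norm T * Num.sqrt (n%:R ^+ m).
Proof.
case=> x x0; rewrite subn1 /= => Tx.
set w := hadamard_pow x m.+1 in Tx.
have w0 : w != 0 by apply: hadamard_pow_neq0.
have Nw : 0 < euclidean_norm w by apply: euclidean_norm_gt0.
pose X (k : 'I_m.+2) := if k == ord0 then map_mx conjc w else x.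
have XE : multilinear_form T X = l * (euclidean_norm w ^+ 2)%:C%C.
  rewrite multilinear_form_tensor_map Tx -sqr_modulus_sum_conj mulr_sumr.
  by apply: eq_bigr => i _; rewrite !mxE mulrCA.
have X0 k : X k != 0.
  rewrite /X; case: ifP => // _; apply: contra w0 => /eqP cw0.
  apply/eqP/matrixP => i j; move/matrixP/(_ i j)/eqP: cw0.
  by rewrite !mxE conjc_eq0 => /eqP.
have := @multilinear_form_le _ _ _ T X X0.
rewrite XE modulusM modulusR ?sqr_ge0 // big_ord_recl /=.
rewrite /X /= prodr_const card_ord euclidean_norm_conj.
(* One of the two factors [euclidean_norm w] on the left cancels against slot 0; the other cancels
   against the right side of the power mean bound. *)
rewrite expr2 mulrCA [X in _ <= X]mulrCA ler_pM2l // => le_lw.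
rewrite -(ler_pM2r Nw); apply: le_trans le_lw _; rewrite -mulrA.
by rewrite ler_wpM2l ?spectral_norm_ge0 // euclidean_norm_pow_le.
Qed.

Lemma powR_half_nat (R : realType) (a : R) (m : nat) :
  0 <= a -> a `^ (m%:R / 2) = Num.sqrt (a ^+ m).
Proof. by move=> a0; rewrite powRrM powR12_sqrt ?powR_ge0 // powR_mulrn. Qed.

Theorem lemma30 (R : realType) (n d : nat) (hn : (1 <= n)%N) (hd : (3 <= d)%N)
    (T : tensor R n d) (hT : partially_symmetric T) :
  spectral_radius T <= spectral_norm T * n%:R `^ ((d%:R - 2) / 2).
Proof.
case: d hd T hT => [|[|m]] // _ T _.
rewrite -natrB // subn2 /= powR_half_nat //.
(* An upper bound passes to [sup] only for a nonempty set. With no eigenvalue, the [sup] is 0 by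
   default and the claim is that the right side is nonnegative, so the existence of eigenvalues need
   not be proved. *)
have [[l eig_l]|no_eig] := pselect (exists l, tensor_eigenvalue T l).
  apply: ge_sup; first by exists (modulus l), l.
  by move=> _ [k eig_k <-]; apply: tensor_eigenvalue_le.
rewrite /spectral_radius sup_out.
  by rewrite mulr_ge0 ?spectral_norm_ge0 ?sqrtr_ge0.
by case=> [[_ [l eig_l _]] _]; apply: no_eig; exists l.
Qed.
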